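(* Let $q$ be a prime power, $n,k,r$ positive integers, $S$ a $(k-r)$-dimensional $\mathbb{F}_q$-subspace of $\mathbb{F}_{q^n}$ and $T$ an $r$-dimensional $\mathbb{F}_q$-subspace of $\mathbb{F}_{q^n}$, with $r\le k-r$. Let $U=S\times T$ and let $i$ be a positive integer. For each $i$ define $$\mathcal{I}_i(S,T)=\bigcup_{\substack{a_1,\ldots,a_i\in T\\ \langle a_1,\ldots,a_i\rangle_{\mathbb{F}_q}\in\mathcal{L}_i(T)}} a_1^{-1}S\cap\cdots\cap a_i^{-1}S,$$ where $\mathcal{L}_i(T)$ is the set of $i$-dimensional $\mathbb{F}_q$-subspaces of $T$ (so the union runs over $\mathbb{F}_q$-linearly independent $a_1,\dots,a_i\in T$). Then the set of points of weight at least $i$ in $L_U$, different from $\langle(1,0)\rangle_{\mathbb{F}_{q^n}}$, is $$\{\langle(\xi,1)\rangle_{\mathbb{F}_{q^n}} : \xi\in\mathcal{I}_i(S,T)\}.$$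
   Context: For an $\mathbb{F}_q$-subspace $U$ of $\mathbb{F}_{q^n}^2$, the $\mathbb{F}_q$-linear set $L_U=\{\langle u\rangle_{\mathbb{F}_{q^n}}: u\in U\setminus\{0\}\}\subseteq \mathrm{PG}(1,q^n)$ has rank $\dim_{\mathbb{F}_q}U$; the weight of a point $P=\langle v\rangle_{\mathbb{F}_{q^n}}$ is $w_{L_U}(P)=\dim_{\mathbb{F}_q}(U\cap\langle v\rangle_{\mathbb{F}_{q^n}})$. $S\times T=\{(s,t): s\in S,\ t\in T\}$, and $a^{-1}S=\{a^{-1}s : s\in S\}$. *)

(* Defs.v *)
From HB Require Import structures.
From mathcomp Require Import all_boot all_order all_algebra all_field.
From mathcomp Require Import boolp classical_sets.

Set Implicit Arguments.
Unset Strict Implicit.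
Unset Printing Implicit Defensive.

Import GRing.Theory.
Local Open Scope ring_scope.

(* [planeF L] and [planeL L] have the same elements, the pairs over [L]; the
   first is a vector space over the base field [F], the second one over [L]. *)
Notation planeF L := (L * L)%type.
Notation planeL L := (L^o * L^o)%type.

Section LinearSets.
Variables (F : finFieldType) (L : fieldExtType F).
Implicit Types (S T : {vspace L}) (U : {vspace planeF L}).
Implicit Types (P : {vspace planeL L}).

Definition prod_vspace S T : {vspace planeF L} :=
  (linfun (@fst L L) @^-1: S :&: linfun (@snd L L) @^-1: T)%VS.

Lemma mem_prod_vspace S T (u : planeF L) :
  (u \in prod_vspace S T) = (u.1 \in S) && (u.2 \in T).
Proof. by rewrite memv_cap -!memv_preim !lfunE. Qed.

Definition scale_pair (v : planeF L) : 'Hom(L, planeF L) :=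
  linfun (fun a : L => (a * v.1, a * v.2) : planeF L).

Lemma scale_pairE (v : planeF L) (a : L) :
  scale_pair v a = (a * v.1, a * v.2).
Proof.
have lin : linear (fun a : L => (a * v.1, a * v.2) : planeF L).
  by move=> c x y; rewrite !mulrDl -!scalerAl.
pose m := GRing.isLinear.Build F L (planeF L) *:%R _ lin.
pose f : {linear L -> planeF L} :=
  HB.pack (fun a : L => (a * v.1, a * v.2) : planeF L) m.
by rewrite -[LHS]/(linfun f a) lfunE.
Qed.

Definition restrict_scalars P : {vspace planeF L} :=
  (\sum_(j < \dim P) limg (scale_pair (vbasis P)`_j))%VS.

Lemma mem_restrict_scalars P (u : planeF L) :
  (u \in restrict_scalars P) = ((u : planeL L) \in P).
Proof.
apply/idP/idP.
- case/memv_sumP => w wP ->.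
  have: \sum_(j < \dim P) (w j : planeL L) \in P.
    apply: memv_suml => j _; have /memv_imgP[a _ ->] := wP j isT.
    rewrite scale_pairE.
    have : (a : L) *: ((vbasis P)`_j : planeL L) \in P.
      by rewrite memvZ // vbasis_mem // mem_nth // size_tuple.
    by [].
  by [].
- move=> uP; have := coord_vbasis uP => uE.
  apply/memv_sumP.
  exists (fun j => (coord (vbasis P) j u *: (vbasis P)`_j : planeL L)) => //.
  move=> j _; apply/memv_imgP; exists (coord (vbasis P) j u); first exact: memvf.
  by rewrite scale_pairE.
Qed.

(* The points of PG(1, L) are the one-dimensional [L]-subspaces of [planeL L];
   the linear set of [U] is a set of such points. *)
Definition linear_set U : set {vspace planeL L} :=
  [set <[u : planeL L]>%VS | u in [set u | u \in U /\ u != 0]]%classic.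

Definition weight U P : nat := \dim (U :&: restrict_scalars P).

Definition calI (i : nat) S T : set L :=
  (\bigcup_(a in [set a : i.-tuple L |
       {subset a <= T} /\ \dim <<a>> = i])
     \bigcap_(j in [set: 'I_i]) [set (tnth a j)^-1 * s | s in [set` S]])%classic.

End LinearSets.

(* Main.v *)
(* Parametrising the affine point <(xi, 1)> by its second coordinate
   identifies its intersection with S x T with the space of those t in T for
   which t * xi lies in S.  A family witnessing xi in I_i(S, T) is exactly an
   independent family of size i in this space. *)

Require Import Defs.
From HB Require Import structures.
From mathcomp Require Import all_boot all_order all_algebra all_field.
From mathcomp Require Import boolp classical_sets.

Set Implicit Arguments.
Unset Strict Implicit.
Unset Printing Implicit Defensive.

Import GRing.Theory.
Local Open Scope ring_scope.

(** Truncating a basis of [W] gives the family; conversely its span lies in [W]. The right-hand side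
    has the shape of the index set of [calI]. *)
Lemma leq_dim_free (K : fieldType) (V : vectType K) (W : {vspace V}) (i : nat) :
  (i <= \dim W)%N <->
  exists a : i.-tuple V, {subset a <= W} /\ \dim <<a>> = i.
Proof.
split=> [le_iW | [a [/span_subvP/dimvS le_aW <-]] //].
have szE : size (take i (vbasis W)) == i.
  by rewrite size_take size_tuple; case: ltngtP le_iW => // ->.
exists (Tuple szE); split=> [x /mem_take /vbasis_mem // |].
have : free (take i (vbasis W) ++ drop i (vbasis W)).
  by rewrite cat_take_drop (basis_free (vbasisP W)).
by move/catl_free; rewrite /free => /eqP ->; apply/eqP.
Qed.

Section AffinePoints.
Variables (F : finFieldType) (L : fieldExtType F).
Implicit Types (S T : {vspace L}) (xi : L).

(* The two sides carry different copies, over [L] and [L^o], of the same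
   operations; stating this once keeps [L^o] out of later computations. *)
Lemma planeL_lineP (u v : planeF L) :
  reflect (exists a : L, u = (a * v.1, a * v.2))
          ((u : planeL L) \in <[v : planeL L]>%VS).
Proof. exact: (@vlineP _ _ (u : planeL L) (v : planeL L)). Qed.

Definition affine_point xi : {vspace planeL L} := <[((xi, 1)%R : planeL L)]>%VS.

Lemma mem_affine_point xi (u : planeF L) :
  ((u : planeL L) \in affine_point xi) = (u.1 == u.2 * xi).
Proof.
apply/(planeL_lineP u (xi, 1))/eqP => [[c ->] /= | uE]; first by rewrite mulr1.
by exists u.2; rewrite /= mulr1 -uE -surjective_pairing.
Qed.

Lemma affine_point_neq_infinity xi :
  affine_point xi <> <[((1, 0)%R : planeL L)]>%VS.
Proof.
move=> E; have: ((1, 0) : planeL L) \in affine_point xi by rewrite E memv_line.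
by rewrite (mem_affine_point xi (1, 0)) /= mul0r oner_eq0.
Qed.

(** Two lines coincide once one contains a nonzero vector of the other, so it is enough to place [u]
    on the right line, according to whether [u.2] vanishes. *)
Lemma line_affine_or_infinity (u : planeF L) : u != 0 ->
  <[u : planeL L]>%VS = <[((1, 0)%R : planeL L)]>%VS \/
  <[u : planeL L]>%VS = affine_point (u.1 / u.2).
Proof.
move=> u0; have line_eq (v : planeL L) :
    (u : planeL L) \in <[v]>%VS -> <[u : planeL L]>%VS = <[v]>%VS.
  (* The line of [v] has dimension at most 1, and that of [u] exactly 1. *)
  move=> uv; apply/eqP; rewrite eqEdim -memvE uv /= !dim_vline.
  by rewrite (u0 : (u : planeL L) != 0) leq_b1.
have [y0 | y0] := eqVneq u.2 0; [left | right]; apply: line_eq.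
  apply/(planeL_lineP u (1, 0)); exists u.1.
  by rewrite /= mulr1 mulr0 -y0 -surjective_pairing.
by rewrite -/(affine_point _) mem_affine_point mulrC divfK.
Qed.

(** The preimage form avoids inverting [xi]: for [xi = 0] the space is all of [T]. *)
Definition slope_space S T xi : {vspace L} :=
  (T :&: amulr xi @^-1: S)%VS.

Lemma mem_slope_space S T xi t :
  (t \in slope_space S T xi) = (t \in T) && (t * xi \in S).
Proof. by rewrite memv_cap -memv_preim lfunE. Qed.

Lemma weight_affine_point S T xi :
  weight (prod_vspace S T) (affine_point xi) = \dim (slope_space S T xi).
Proof.
have -> : weight (prod_vspace S T) (affine_point xi) =
          \dim (Defs.scale_pair (xi, 1%R) @: slope_space S T xi)%VS.
  congr (\dim _); apply/vspaceP => -[x y]; rewrite memv_cap.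
  rewrite mem_restrict_scalars mem_affine_point mem_prod_vspace /=.
  apply/idP/memv_imgP => [/andP[/andP[xS yT] /eqP xE] | [t]].
    exists y; first by rewrite mem_slope_space yT -xE.
    by rewrite Defs.scale_pairE /= mulr1 xE.
  rewrite mem_slope_space Defs.scale_pairE /= mulr1 => /andP[tT tS] [-> ->].
  by rewrite tT tS eqxx.
(* The map sending [t] to [(t * xi, t)] is injective, as its second coordinate returns [t]. *)
apply/limg_dim_eq/eqP; rewrite -subv0; apply/subvP => t.
rewrite memv_cap memv_ker memv0 => /andP[_].
by rewrite Defs.scale_pairE /= mulr1 => /eqP[_ ->].
Qed.

(** Positive weight provides a nonzero [t] in the slope space; then [(t * xi, t)] is a nonzero
    vector of [S x T] that spans the point. *)
Lemma linear_set_affine_point S T xi :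
  (0 < weight (prod_vspace S T) (affine_point xi))%N ->
  linear_set (prod_vspace S T) (affine_point xi).
Proof.
rewrite weight_affine_point lt0n dimv_eq0 -vpick0.
have := memv_pick (slope_space S T xi); move: (vpick _) => t.
rewrite mem_slope_space => /andP[tT tS] t0.
have u0 : ((t * xi, t) : planeF L) != 0.
  by apply: contra t0 => /eqP[_ ->].
exists (t * xi, t); first by split; rewrite // mem_prod_vspace /= tS tT.
have [E | ->] := line_affine_or_infinity u0; last by rewrite /= mulrC mulKf.
(* Lying on the point at infinity would force [t = 0]. *)
have := memv_line ((t * xi, t) : planeL L); rewrite E.
by case/(planeL_lineP _ (1, 0)) => c [_] /=; rewrite mulr0 => /eqP/(negP t0).
Qed.

(** Entries of a free family are nonzero, so [xi] lies in [a_j^-1 S] exactly when [a_j * xi] lies in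
    [S]; the convention [0^-1 = 0] never interferes. *)
Lemma calI_slope_space (i : nat) S T xi :
  calI i S T xi <-> (i <= \dim (slope_space S T xi))%N.
Proof.
rewrite leq_dim_free; split=> -[a].
  case=> aT dim_a aS; exists a; split=> // t ta; rewrite mem_slope_space aT //.
  have /tnthP[j tE] := ta; have [s sS /= sE] := aS j I.
  have t0 : t != 0.
    have a_free : free a by rewrite /free dim_a size_tuple.
    by apply: contraNneq (free_not0 a_free ta) => ->.
  by rewrite -sE -tE mulrA divff // mul1r.
case=> aW dim_a; exists a.
  by split=> // t /aW; rewrite mem_slope_space => /andP[].
move=> j _; have ja := mem_tnth j a.
have := aW _ ja; rewrite mem_slope_space => /andP[_ jS].
exists (tnth a j * xi) => //; rewrite mulKf //.
have a_free : free a by rewrite /free dim_a size_tuple.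
by apply: contraTneq ja => ->; apply/negP => /(free_not0 a_free); rewrite eqxx.
Qed.

End AffinePoints.

Theorem theorem3p2 (F : finFieldType) (L : fieldExtType F)
    (q n k r i : nat) (S T : {vspace L})
    (q_def : #|F| = q) (n_def : \dim {: L} = n)
    (n_gt0 : (0 < n)%N) (k_gt0 : (0 < k)%N) (r_gt0 : (0 < r)%N)
    (dimS : \dim S = (k - r)%N) (dimT : \dim T = r)
    (le_r_kr : (r <= k - r)%N) (i_gt0 : (0 < i)%N) :
  let U := prod_vspace S T in
  ([set P | [/\ linear_set U P, (i <= weight U P)%N
               & P <> <[((1, 0)%R : planeL L)]>%VS]]
   = [set <[((xi, 1)%R : planeL L)]>%VS | xi in calI i S T])%classic.
Proof.
apply/seteqP; split=> P /=.
  case=> -[u [_ u0] <-] le_iw neq.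
  have [// | uE] := line_affine_or_infinity u0.
  exists (u.1 / u.2); last by rewrite uE.
  by apply/calI_slope_space; rewrite -weight_affine_point -uE.
case=> xi /calI_slope_space.
rewrite -weight_affine_point => le_iw <-; split=> //.
  (* Since [i] is positive, weight at least [i] already places the point in the linear set. *)
  exact/linear_set_affine_point/(leq_trans i_gt0).
exact: affine_point_neq_infinity.
Qed.
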